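(* For $n\ge0$ let $$\widehat Q_n=\sum_{\sigma\in\mathfrak S^{\rm ca}_{2n}} x_{\rm e}^{\mathrm{eareccpeakeven}(\sigma)}y_{\rm e}^{\mathrm{cvaleven}(\sigma)}u_{\rm e}^{\mathrm{nrcpeakeven}(\sigma)}x_{\rm o}^{\mathrm{eareccpeakodd}(\sigma)}y_{\rm o}^{\mathrm{cvalodd}(\sigma)}u_{\rm o}^{\mathrm{nrcpeakodd}(\sigma)}$$ $$\times\,p_{-1}^{\mathrm{lcrosscpeakeven}(\sigma)}q_{-1}^{\mathrm{lnestcpeakeven}(\sigma)}p_{-2}^{\mathrm{lcrosscpeakodd}(\sigma)}q_{-2}^{\mathrm{lnestcpeakodd}(\sigma)}p_{+1}^{\mathrm{ucrosscvalodd}(\sigma)+\mathrm{unestcvalodd}(\sigma)}p_{+2}^{\mathrm{ucrosscvaleven}(\sigma)+\mathrm{unestcvaleven}(\sigma)}\lambda^{\mathrm{cyc}(\sigma)},$$ all variables being indeterminates. Then, as formal power series in $t$, $\sum_{n\ge0}\widehat Q_n t^n=\cfrac{1}{1-\cfrac{\alpha_1 t}{1-\cfrac{\alpha_2 t}{1-\cdots}}}$ with, for all $k\ge1$, $$\alpha_{2k-1}=(\lambda+2k-2)\bigl(p_{-1}^{2k-2}x_{\rm e}+q_{-1}[2k-2]_{p_{-1},q_{-1}}u_{\rm e}\bigr)p_{+1}^{2k-2}y_{\rm o},$$ $$\alpha_{2k}=(\lambda+2k-1)\bigl(p_{-2}^{2k-1}x_{\rm o}+q_{-2}[2k-1]_{p_{-2},q_{-2}}u_{\rm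 o}\bigr)p_{+2}^{2k-1}y_{\rm e}.$$
   Context: $[m]_{p,q}=\sum_{j=0}^{m-1}p^jq^{m-1-j}$. For a permutation $\sigma$ of $[N]$, an index $i$ is a cycle peak if $\sigma^{-1}(i)<i>\sigma(i)$, a cycle valley if $\sigma^{-1}(i)>i<\sigma(i)$, a cycle double rise if $\sigma^{-1}(i)<i<\sigma(i)$, a cycle double fall if $\sigma^{-1}(i)>i>\sigma(i)$, a fixed point if $\sigma(i)=i$; $\sigma$ is cycle-alternating if it has no cycle double rises, cycle double falls or fixed points; $\mathfrak S^{\rm ca}_{2n}$ is the set of cycle-alternating permutations of $[2n]$; $\mathrm{cyc}(\sigma)$ is its number of cycles. An index $i$ is a record if $\sigma(j)<\sigma(i)$ for all $j<i$, an antirecord if $\sigma(j)>\sigma(i)$ for all $j>i$; exclusive antirecord = antirecord not record; neither-record-antirecord = neither. $\mathrm{eareccpeakeven}(\sigma)$ = number of even cycle peaks that are exclusive antirecords, $\mathrm{nrcpeakeven}(\sigma)$ = number of even cycle peaks that are neither-record-antirecords, $\mathrm{cvaleven}(\sigma)$ = number of even cycle valleys; ''odd'' analogues use odd indices. $\mathrm{ucross}(j,\sigma)=\#\{i<j<k<l: k=\sigma(i), l=\sigma(j)\}$, $\mathrm{unest}(j,\sigma)=\#\{i<j<k<l: k=\sigma(j), l=\sigma(i)\}$, $\mathrm{lcross}(k,\sigma)=\#\{i<j<k<l: i=\sigma(k), j=\sigma(l)\}$, $\mathrm{lnest}(k,\sigma)=\#\{i<j<k<l: i=\sigma(l), j=\sigma(k)\}$.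 $\mathrm{lcrosscpeakeven}(\sigma)$ and $\mathrm{lnestcpeakeven}(\sigma)$ are the sums of $\mathrm{lcross}(k,\sigma)$, resp. $\mathrm{lnest}(k,\sigma)$, over even cycle peaks $k$; $\mathrm{ucrosscvaleven}(\sigma)$ and $\mathrm{unestcvaleven}(\sigma)$ are the sums of $\mathrm{ucross}(j,\sigma)$, resp. $\mathrm{unest}(j,\sigma)$, over even cycle valleys $j$; ''odd'' analogues sum over odd indices. (This is the paper's 17-variable polynomial specialized to $v_{\rm e}=y_{\rm e}$, $v_{\rm o}=y_{\rm o}$, $q_{+1}=p_{+1}$, $q_{+2}=p_{+2}$.) *)

(* Defs.v *)
From mathcomp Require Import all_boot all_order all_algebra all_fingroup.
From mathcomp Require Import mpoly zify.

Set Implicit Arguments.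
Unset Strict Implicit.
Unset Printing Implicit Defensive.

Import GRing.Theory.

(* ------------------------- permutation statistics ------------------------- *)

Section PermStat.
Variable N : nat.
Implicit Types (s : 'S_N) (i j k l : 'I_N) (P : pred 'I_N).

(* The ordinal i : 'I_N = {0, ..., N-1} stands for the index i + 1 of
   [N] = {1, ..., N}.  The shift preserves the order but flips parity. *)
Definition idx_even i := ~~ odd i.+1.
Definition idx_odd i := odd i.+1.

Definition cpeak s i := ((s^-1)%g i < i) && (s i < i).
Definition cval s i := (i < (s^-1)%g i) && (i < s i).
Definition cdrise s i := ((s^-1)%g i < i) && (i < s i).
Definition cdfall s i := (i < (s^-1)%g i) && (s i < i).
Definition fixpt s i := s i == i.

Definition cycle_alternating s :=
  [forall i : 'I_N, [&& ~~ cdrise s i, ~~ cdfall s i & ~~ fixpt s i]].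

Definition cyc s := #|porbits s|.

Definition record s i := [forall j : 'I_N, (j < i) ==> (s j < s i)].
Definition antirecord s i := [forall j : 'I_N, (i < j) ==> (s i < s j)].
Definition exclusive_antirecord s i := antirecord s i && ~~ record s i.
Definition neither_record_antirecord s i := ~~ record s i && ~~ antirecord s i.

(* In the next four counts, the triple x lists the three remaining indices
   of the quadruple i < j < k < l in increasing order. *)
Definition ucross j s := #|[set x : 'I_N * 'I_N * 'I_N |
  let: (i, k, l) := x in [&& i < j, j < k, k < l, k == s i & l == s j]]|.
Definition unest j s := #|[set x : 'I_N * 'I_N * 'I_N |
  let: (i, k, l) := x in [&& i < j, j < k, k < l, k == s j & l == s i]]|.
Definition lcross k s := #|[set x : 'I_N * 'I_N * 'I_N |
  let: (i, j, l) := x in [&& i < j, j < k, k < l, i == s k & j == s l]]|.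
Definition lnest k s := #|[set x : 'I_N * 'I_N * 'I_N |
  let: (i, j, l) := x in [&& i < j, j < k, k < l, i == s l & j == s k]]|.

(* P is idx_even or idx_odd, selecting the "even" or "odd" statistic. *)
Definition eareccpeak P s :=
  #|[set i | [&& P i, cpeak s i & exclusive_antirecord s i]]|.
Definition nrcpeak P s :=
  #|[set i | [&& P i, cpeak s i & neither_record_antirecord s i]]|.
Definition cvals P s := #|[set i | P i && cval s i]|.
Definition lcrosscpeak P s := \sum_(k | P k && cpeak s k) lcross k s.
Definition lnestcpeak P s := \sum_(k | P k && cpeak s k) lnest k s.
Definition ucrosscval P s := \sum_(j | P j && cval s j) ucross j s.
Definition unestcval P s := \sum_(j | P j && cval s j) unest j s.

End PermStat.

Local Open Scope ring_scope.

Definition pq_bracket (R : comNzRingType) (p q : R) (m : nat) : R :=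
  \sum_(j < m) p ^+ j * q ^+ (m - 1 - j).

(* ------------------------- the generating polynomial ---------------------- *)

(* Integer polynomials in thirteen indeterminates; the trailing m in p_m1, ...
   (resp. p in p_p1, ...) is the sign of the subscript -1, ... (resp. +1, ...). *)
Definition ZX : comNzRingType := {mpoly int[13]}.

Definition var (i : nat) : ZX := @mpolyX 13 int U_(inord i)%MM.

Definition x_e : ZX := var 0.
Definition y_e : ZX := var 1.
Definition u_e : ZX := var 2.
Definition x_o : ZX := var 3.
Definition y_o : ZX := var 4.
Definition u_o : ZX := var 5.
Definition p_m1 : ZX := var 6.
Definition q_m1 : ZX := var 7.
Definition p_m2 : ZX := var 8.
Definition q_m2 : ZX := var 9.
Definition p_p1 : ZX := var 10.
Definition p_p2 : ZX := var 11.
Definition lam : ZX := var 12.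

Definition Qhat (n : nat) : ZX :=
  \sum_(s : 'S_(2 * n) | cycle_alternating s)
    x_e ^+ eareccpeak (@idx_even _) s * y_e ^+ cvals (@idx_even _) s
  * u_e ^+ nrcpeak (@idx_even _) s
  * x_o ^+ eareccpeak (@idx_odd _) s * y_o ^+ cvals (@idx_odd _) s
  * u_o ^+ nrcpeak (@idx_odd _) s
  * p_m1 ^+ lcrosscpeak (@idx_even _) s * q_m1 ^+ lnestcpeak (@idx_even _) s
  * p_m2 ^+ lcrosscpeak (@idx_odd _) s * q_m2 ^+ lnestcpeak (@idx_odd _) s
  * p_p1 ^+ (ucrosscval (@idx_odd _) s + unestcval (@idx_odd _) s)
  * p_p2 ^+ (ucrosscval (@idx_even _) s + unestcval (@idx_even _) s)
  * lam ^+ cyc s.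

(* ---------------- formal power series and continued fractions ------------- *)

Section PowerSeries.
Variable R : comNzRingType.

(* f : fps represents \sum_n (f n) t^n. *)
Definition fps := nat -> R.
Implicit Types (f g h : fps) (a : nat -> R).

Definition fps1 : fps := fun n => (n == 0)%N%:R.
Definition fps_sub f g : fps := fun n => f n - g n.
Definition fps_mul f g : fps := fun n => \sum_(i < n.+1) f i * g (n - i)%N.
Definition fps_exp f (k : nat) : fps := iter k (fps_mul f) fps1.

(* The series (c t) h. *)
Definition fps_ct (c : R) h : fps := fun n => if n is m.+1 then c * h m else 0.

(* 1 / (1 - h) = \sum_k h^k for h without constant term: only the terms
   k <= n contribute to the coefficient of t^n. *)
Definition fps_inv1B h : fps := fun n => \sum_(k < n.+1) fps_exp h k n.

Lemma fps_exp_small h k n : h 0%N = 0 -> (n < k)%N -> fps_exp h k n = 0.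
Proof.
move=> h0; elim: k n => // k IHk n ltnk.
rewrite /fps_exp iterS -/(fps_exp h k) /fps_mul big1 // => -[[|i] /= ltin] _.
  by rewrite h0 mul0r.
by rewrite IHk ?mulr0 //; lia.
Qed.

Lemma fps_inv1BP h : h 0%N = 0 ->
  fps_mul (fps_sub fps1 h) (fps_inv1B h) =1 fps1.
Proof.
move=> h0 n.
have extend m : (m <= n)%N -> fps_inv1B h m = \sum_(k < n.+1) fps_exp h k m.
  move=> lemn; rewrite /fps_inv1B -!(big_mkord xpredT (fun k => fps_exp h k m)).
  rewrite (@big_cat_nat _ _ _ m.+1 0 n.+1) //=.
  rewrite [X in _ + X]big_nat [X in _ + X]big1 ?addr0 // => k /andP[ltmk _].
  exact: fps_exp_small.
have mul1 g : fps_mul fps1 g n = g n.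
  rewrite /fps_mul big_ord_recl /= mul1r subn0 big1 ?addr0 // => i _.
  by rewrite mul0r.
transitivity (\sum_(k < n.+1) (fps_exp h k n - fps_exp h k.+1 n)).
  rewrite -[RHS](_ : \sum_(k < n.+1) fps_mul (fps_sub fps1 h) (fps_exp h k) n = _).
    rewrite /fps_mul exchange_big /=; apply: eq_bigr => i _.
    by rewrite extend ?leq_subr // mulr_sumr.
  apply: eq_bigr => k _; rewrite -[fps_exp h k n]mul1 /fps_exp iterS /fps_mul.
  by rewrite -sumrB; apply: eq_bigr => i _; rewrite mulrBl.
rewrite -(big_mkord xpredT (fun k => fps_exp h k n - fps_exp h k.+1 n)).
under eq_bigr => k _ do rewrite -opprB.
rewrite sumrN (telescope_sumr (fps_exp h ^~ n)) // opprB.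
by rewrite [fps_exp h n.+1 n]fps_exp_small // subr0.
Qed.

(* The K-th convergent, starting at index m:
   1 / (1 - a_m t / (1 - ... / (1 - a_{m+K-1} t))). *)
Fixpoint sfrac_conv a (m K : nat) : fps :=
  if K is K'.+1 then fps_inv1B (fps_ct (a m) (sfrac_conv a m.+1 K')) else fps1.

(* Convergence in the t-adic topology. *)
Definition fps_cvg (F : nat -> fps) f :=
  forall n, exists K0, forall K, (K0 <= K)%N -> F K n = f n.

(* f = 1 / (1 - a_1 t / (1 - a_2 t / (1 - ...))); the value a_0 is unused. *)
Definition is_sfrac f a := fps_cvg (sfrac_conv a 1) f.

End PowerSeries.

(* Main.v *)
(* Scan the indices from left to right.  The arcs of s between the indices
   already read form closed cycles and h open chains, each with one pending
   outgoing and one pending incoming arc; h goes up by 1 at a cycle valley and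
   down by 1 at a cycle peak.  At a valley, ucross + unest is the height h.  A
   peak k closes the pending incoming arc of one chain and the pending outgoing
   arc of another or the same one, with h choices each: if s k has r pending
   targets below it, then lnest = r and lcross = h - 1 - r, and k is an
   antirecord iff r = 0; a cycle is closed iff the two chains coincide, so for
   each s k the outgoing choice contributes lam + h - 1.  The polynomials thus
   count weighted Dyck paths, and Flajolet's theorem turns rise(h) * fall(h + 1)
   into the coefficient alpha_(h + 1). *)

Require Import Defs.
From mathcomp Require Import all_boot all_order all_algebra all_fingroup.
From mathcomp Require Import mpoly.
From mathcomp Require Import zify ring.

Set Implicit Arguments.
Unset Strict Implicit.
Unset Printing Implicit Defensive.

Import GRing.Theory.
Local Open Scope ring_scope.

(** * Continued fractions and Dyck paths *)

Section ContinuedFraction.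
Variable R : comNzRingType.
Implicit Types f g : fps R.

(** Degrees up to [n] see only the truncations of the series to polynomials, whose product is
    associative. *)
Lemma fps_mulA f g (h : fps R) :
  fps_mul f (fps_mul g h) =1 fps_mul (fps_mul f g) h.
Proof.
move=> n; pose T u : {poly R} := \poly_(i < n.+1) u i.
have coefT u i : (i <= n)%N -> (T u)`_i = u i by rewrite coef_poly ltnS => ->.
have coefTM u v i : (i <= n)%N -> (T u * T v)`_i = fps_mul u v i.
  move=> lein; rewrite coefM; apply: eq_bigr => j _.
  by rewrite !coefT //; have := ltn_ord j; lia.
transitivity (T f * (T g * T h))`_n.
  rewrite coefM; apply: eq_bigr => j _.
  by rewrite coefT ?coefTM //; have := ltn_ord j; lia.
rewrite mulrA coefM; apply: eq_bigr => j _.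
by rewrite coefT ?coefTM //; have := ltn_ord j; lia.
Qed.

Lemma fps_inv1B_ct0 c g : fps_inv1B (fps_ct c g) 0%N = 1 :> R.
Proof. by rewrite /fps_inv1B big_ord_recl big_ord0 addr0. Qed.

Lemma fps_inv1B_ctS c g n :
  fps_inv1B (fps_ct c g) n.+1 = c * fps_mul g (fps_inv1B (fps_ct c g)) n.
Proof.
have := fps_inv1BP (erefl : fps_ct c g 0%N = 0) n.+1.
rewrite {1}/fps_mul big_ord_recl /= /fps_sub /= /fps1 /= subr0 mul1r subn0.
move/eqP; rewrite addr_eq0 => /eqP->; rewrite -sumrN mulr_sumr.
by apply: eq_bigr => i _; rewrite /= sub0r mulNr opprK mulrA subSS.
Qed.

Section Dyck.
Variables rise fall : nat -> R.

(* Weighted count of the lattice paths with m steps from height h to 0. *)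
Fixpoint dyck (m h : nat) : R :=
  if m is m'.+1 then rise h * dyck m' h.+1 + fall h * dyck m' h.-1
  else (h == 0)%N%:R.

Lemma dyck_small m h : (m < h)%N -> dyck m h = 0.
Proof.
elim: m h => [|m IHm] [|h] //= lt_mh.
by rewrite !IHm ?mulr0 ?addr0 //; lia.
Qed.

(** In [dyck], [0.-1] is [0]: this condition keeps a fall at height 0 from counting as a level
    step. *)
Hypothesis fall0 : fall 0 = 0.
Variable a : nat -> R.
Hypothesis aE : forall h, a h.+1 = rise h * fall h.+1.

(* [tails K h] is s_h * ... * s_0, where s_k is the truncated tail of the
   continued fraction starting at a_(k+1).  A path from h to 0 splits at its
   first passages below h, h - 1, ..., 1 into excursions counted by the s_k. *)
Fixpoint tails (K h : nat) : fps R :=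
  let s := sfrac_conv a h.+1 (K - h) in
  if h is h'.+1 then fps_mul s (tails K h') else s.

Lemma sfrac_conv0 m K : sfrac_conv a m K 0%N = 1.
Proof. by case: K => [|K] //=; rewrite fps_inv1B_ct0. Qed.

Lemma tails0 K h : tails K h 0%N = 1.
Proof.
elim: h => [|h IHh]; first exact: sfrac_conv0.
by rewrite /= /fps_mul big_ord_recl big_ord0 addr0 IHh sfrac_conv0 mulr1.
Qed.

(** Multiply [s_h = 1 + a_(h+1) t s_(h+1) s_h] by [tails K (h - 1)], read as 1 when [h = 0], and
    compare coefficients. *)
Lemma tailsS K h n : (h < K)%N ->
  tails K h n.+1 =
  (if h is h'.+1 then tails K h' n.+1 else 0) + a h.+1 * tails K h.+1 n.
Proof.
move=> lt_hK; have eK : (K - h = (K - h.+1).+1)%N by lia.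
set s1 := sfrac_conv a h.+2 (K - h.+1).
set s := fps_inv1B (fps_ct (a h.+1) s1).
have es : sfrac_conv a h.+1 (K - h) = s by rewrite eK.
have tailsE j :
  tails K j.+1 = fps_mul (sfrac_conv a j.+2 (K - j.+1)) (tails K j) by [].
case: h => [|h] in lt_hK eK s1 s es *.
  by rewrite tailsE -/s1 /= es /s fps_inv1B_ctS add0r.
rewrite !tailsE -/s1 es [LHS]/fps_mul big_ord_recl {1}/s fps_inv1B_ct0 mul1r.
rewrite subn0; congr (_ + _); rewrite fps_mulA /fps_mul mulr_sumr.
apply: eq_bigr => i _.
by rewrite /= /bump /= add1n subSS /s fps_inv1B_ctS mulrA.
Qed.

(** Both sides obey the same recurrence on the first step of the path. The [h] unmatched falls give
    the product; every other fall pairs with a rise into a coefficient of [a]. No step increases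
    [n + h], so the truncation at depth [K] is not felt. *)
Lemma dyck_tails K n h : (n + h <= K)%N ->
  dyck (2 * n + h) h = (\prod_(j < h) fall j.+1) * tails K h n.
Proof.
have [m] := ubnP (n + n + h); elim: m n h => // m IHm n h le_m leK.
have up n' : n = n'.+1 ->
    dyck (2 * n' + h.+1) h.+1 = (\prod_(j < h.+1) fall j.+1) * tails K h.+1 n'.
  by move=> en; apply: IHm; lia.
have down h' : h = h'.+1 ->
    dyck (2 * n + h') h' = (\prod_(j < h') fall j.+1) * tails K h' n.
  by move=> eh; apply: IHm; lia.
case: n => [|n] in le_m leK up down *.
  case: h => [|h] in le_m leK up down *.
    by rewrite tails0 /= big_ord0 mulr1.
  (* For [n = 0] a first step up leaves too few steps to come back to 0. *)
  rewrite muln0 add0n /= dyck_small //.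
  have := down h erefl; rewrite muln0 add0n => ->.
  by rewrite tails0 -/(tails K h.+1) tails0 big_ord_recr /=; ring.
have -> : (2 * n.+1 + h = (2 * n + h.+1).+1)%N by lia.
rewrite [LHS]/= (up n erefl) tailsS ?aE; last by lia.
case: h => [|h] in le_m leK up down *.
  by rewrite fall0 big_ord_recr big_ord0 /=; ring.
have -> : (2 * n + h.+2 = 2 * n.+1 + h)%N by lia.
by rewrite [h.+1.-1]/= (down h erefl) !big_ord_recr /=; ring.
Qed.

Lemma is_sfrac_dyck : is_sfrac (fun n => dyck (2 * n) 0) a.
Proof.
move=> n; exists n => K leK.
have := @dyck_tails K n 0; rewrite !addn0 => -> //.
by rewrite big_ord0 mul1r /= subn0.
Qed.

End Dyck.
End ContinuedFraction.

(** * Permutation statistics *)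

Section Counting.
Variables (T : finType) (R : nmodType).

(** By injectivity each rank below [#|O|] is taken exactly once; the induction removes the element
    with the largest [v]. *)
Lemma sum_rank (v : T -> nat) (O : {set T}) (G : nat -> R) : injective v ->
  \sum_(e in O) G #|[set x in O | (v x < v e)%N]| = \sum_(r < #|O|) G r.
Proof.
move=> v_inj; have [n] := ubnP #|O|; elim: n O => // n IHn O.
have [->|[z Oz]] := set_0Vmem O; first by rewrite cards0 big_set0 big_ord0.
have [e] := arg_maxnP v Oz; rewrite -/(e \in O) => Oe max_e.
rewrite (cardsD1 e) Oe add1n ltnS => leOn.
rewrite (bigD1 e) //= big_ord_recr /= addrC; congr (_ + _).
  rewrite -IHn //; apply: eq_big => [x|x /andP[Ox nxe]].
    by rewrite !inE andbC.
  congr (G #|pred_of_set _|); apply/setP => y; rewrite !inE.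
  have [->|//] := eqVneq y e; rewrite andbC /=.
  by rewrite ltnNge; have /= -> := max_e x Ox.
congr (G #|pred_of_set _|); apply/setP => y; rewrite !inE andbC.
case Oy: (y \in O); rewrite ?andbF ?andbT // ltn_neqAle (inj_eq v_inj).
by have /= -> := max_e y Oy; rewrite andbT.
Qed.

Lemma sum_rank2 (v : T -> nat) (O : {set T}) (G : nat -> nat -> R) :
  injective v ->
  \sum_(e in O) G #|[set x in O | (v e < v x)%N]|
                  #|[set x in O | (v x < v e)%N]|
  = \sum_(r < #|O|) G (#|O|.-1 - r)%N r.
Proof.
move=> v_inj; rewrite -(sum_rank O (fun r => G (#|O|.-1 - r)%N r) v_inj).
apply: eq_bigr => e Oe; congr G.
rewrite (cardsD1 e O) Oe add1n /=.
rewrite -[in RHS](cardsID [set x | (v x < v e)%N] (O :\ e)).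
rewrite (_ : _ :&: _ = [set x in O | (v x < v e)%N]) ?addKn; last first.
  apply/setP => x; rewrite !inE.
  by have [->|] := eqVneq x e; rewrite ?ltnn ?andbF.
apply: eq_card => x; rewrite !inE -leqNgt ltn_neqAle (inj_eq v_inj) eq_sym.
by case: (x == e); rewrite /= ?andbF // andbC.
Qed.

End Counting.

Lemma invariant_porbit (T : finType) (T' : Type) (s : {perm T}) (f : T -> T') :
  (forall x, f (s x) = f x) -> forall x y, x \in porbit s y -> f x = f y.
Proof.
move=> fs x y /porbitP[i ->]; elim: i => [|i IHi]; first by rewrite expg0 perm1.
by rewrite expgSr permM fs.
Qed.

Section Statistics.
Local Open Scope nat_scope.
Variables (N : nat) (s : 'S_N).

(** An arc passing over [j] from an earlier [i] is a crossing or a nesting according to whether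
    [s i] is below or above [s j]. *)
Lemma ucross_unestE j : cval s j ->
  (ucross j s + unest j s) = #|[set i : 'I_N | (i < j) && (j < s i)]|.
Proof.
move=> /andP[_ lt_j_sj].
have -> : ucross j s = #|[set i : 'I_N | [&& i < j, j < s i & s i < s j]]|.
  rewrite -(@card_imset _ _ (fun i => (i, s i, s j))); last by move=> x y [].
  apply: eq_card => -[[x y] z]; rewrite inE; apply/idP/imsetP.
    case/and5P=> xj jy yz /eqP ey /eqP ez; exists x; last by rewrite ey ez.
    by rewrite inE xj -ey -ez jy.
  by case=> x'; rewrite inE => /and3P[lt1 lt2 lt3] [-> -> ->]; apply/and5P.
have -> : unest j s = #|[set i : 'I_N | [&& i < j, j < s i & s j < s i]]|.
  rewrite -(@card_imset _ _ (fun i => (i, s j, s i))); last by move=> x y [].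
  apply: eq_card => -[[x y] z]; rewrite inE; apply/idP/imsetP.
    case/and5P=> xj jy yz /eqP ey /eqP ez; exists x; last by rewrite ey ez.
    by rewrite inE xj -ey -ez yz (ltn_trans jy).
  by case=> x'; rewrite inE => /and3P[lt1 lt2 lt3] [-> -> ->]; apply/and5P.
rewrite -[RHS](cardsID [set i : 'I_N | s i < s j]).
congr (_ + _); apply: eq_card => i; rewrite !inE.
  by rewrite andbA.
have [->|ne] := eqVneq i j; first by rewrite !ltnn.
rewrite -leqNgt [(s j <= _)]leq_eqVlt.
rewrite (_ : (val (s j) == val (s i)) = false) /=; last first.
  by apply: contraNF ne => /eqP/val_inj/perm_inj ->.
by rewrite [RHS]andbC andbA.
Qed.

Lemma lcrossE k :
  lcross k s = #|[set l : 'I_N | [&& s k < s l, s l < k & k < l]]|.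
Proof.
rewrite -(@card_imset _ _ (fun l => (s k, s l, l))); last by move=> x y [].
apply: eq_card => -[[x y] z]; rewrite inE; apply/idP/imsetP.
  case/and5P=> xy yk kz /eqP ex /eqP ey; exists z; last by rewrite ex ey.
  by rewrite inE -ex -ey xy yk.
by case=> l; rewrite inE => /and3P[lt1 lt2 lt3] [-> -> ->]; apply/and5P.
Qed.

Lemma lnestE k : (s k < k) ->
  lnest k s = #|[set l : 'I_N | (k < l) && (s l < s k)]|.
Proof.
move=> lt_sk_k; rewrite -(@card_imset _ _ (fun l => (s l, s k, l))); last first.
  by move=> x y [].
apply: eq_card => -[[x y] z]; rewrite inE; apply/idP/imsetP.
  case/and5P=> xy yk kz /eqP ex /eqP ey; exists z; last by rewrite ex ey.
  by rewrite inE kz -ex -ey xy.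
by case=> l; rewrite inE => /andP[lt1 lt2] [-> -> ->]; apply/and5P.
Qed.

(** The index [s^-1 k] precedes [k] but has the larger image [k]. *)
Lemma cpeak_record k : cpeak s k -> record s k = false.
Proof.
case/andP=> lt_k lt_sk; apply/negP => /forallP/(_ (s^-1 k)%g).
by rewrite lt_k permKV /= ltnNge ltnW.
Qed.

Lemma cpeak_antirecord k : cpeak s k -> antirecord s k = (lnest k s == 0).
Proof.
case/andP=> _ lt_sk; rewrite lnestE // cards_eq0.
apply/forallP/eqP => [H|/setP H x].
  apply/setP => x; rewrite !inE; have := H x.
  by case: (k < x) => //= /ltnW; rewrite leqNgt => /negbTE.
apply/implyP => lt_kx; have := H x; rewrite !inE lt_kx /= => /negbT.
rewrite -leqNgt leq_eqVlt => /orP[/eqP/val_inj/perm_inj ekx|//].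
by rewrite ekx ltnn in lt_kx.
Qed.

Lemma cpeakP k : cycle_alternating s -> cpeak s k = ~~ cval s k.
Proof.
move/forallP/(_ k); rewrite /cdrise /cdfall /fixpt /cpeak /cval.
have [->|ne] := eqVneq (s k) k; first by rewrite !andbF.
have ne' : ((s^-1)%g k != k) by apply: contraNneq ne => {1}<-; rewrite permKV.
have ltNgt (x : 'I_N) : x != k -> (x < k) = ~~ (k < x).
  by move=> nx; rewrite -leqNgt [RHS]leq_eqVlt (inj_eq val_inj) (negbTE nx).
by rewrite !ltNgt //; case: (k < s k); case: (k < _).
Qed.

End Statistics.

(** * Partial permutations and open chains *)

Section PartialPermutations.
Variable N : nat.
Local Open Scope nat_scope.
Implicit Types (p s : 'S_N) (O : {set 'I_N}) (f : 'I_N -> 'I_N).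

(* The arcs of s between indices < i are encoded by the permutation p that
   closes every open chain into a cycle and the set O of the chain ends: the
   open chain ending at a starts at p a. *)
Definition extends i p O s :=
  [forall a : 'I_N, (a < i) ==> if a \in O then i <= s a else s a == p a].

(* The labelling f is constant on the cycles of p; it witnesses that distinct
   chain ends and distinct unused indices lie on distinct cycles. *)
Definition chain_state i p O f :=
  [/\ forall a : 'I_N, i <= a -> p a = a, forall a, a \in O -> a < i,
      forall a, f (p a) = f a
    & {in [pred a : 'I_N | (a \in O) || (i <= a)] &, injective f}].

(* Joins the chain ending at a to the chain ending at e through i. *)
Definition insert p (i a e : 'I_N) : 'S_N := (tperm a e * (tperm e i * p))%g.

Lemma extendsP i p O s (a : 'I_N) : extends i p O s -> a < i ->
  if a \in O then is_true (i <= s a) else s a = p a.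
Proof. by move=> /forallP/(_ a)/implyP H /H; case: ifP => // _ /eqP. Qed.

Lemma chain_state_lt i p O f (a : 'I_N) :
  chain_state i p O f -> (p a < i) = (a < i).
Proof.
case=> fixp _ _ _; have [le_ia|lt_ai] := leqP i a.
  by rewrite fixp // ltnNge le_ia.
rewrite ltnNge; apply/negP => le_ip; have /perm_inj e := fixp _ le_ip.
by rewrite e leqNgt lt_ai in le_ip.
Qed.

(** The case [a = e] is included: the chain of [a] is then closed into a cycle through [i]. *)
Lemma insertE p (i a e : 'I_N) x : p i = i -> a != i -> e != i ->
  insert p i a e x =
  if x == a then i else if x == i then p e else if x == e then p a else p x.
Proof.
move=> pi nai nei; rewrite /insert !permM.
have [->|nxa] := eqVneq x a; first by rewrite tpermL tpermL.
have [->|nxi] := eqVneq x i; first by rewrite (tpermD nai nei) tpermR.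
have [ex|nxe] := eqVneq x e; last by rewrite !tpermD // eq_sym.
by rewrite ex in nxa *; rewrite tpermR tpermD // eq_sym.
Qed.

(** * Reading one more index *)

Section Step.
Variables (i : 'I_N) (p : 'S_N) (O : {set 'I_N}) (f : 'I_N -> 'I_N).
Hypothesis st : chain_state i p O f.

Let fixi : p i = i. Proof. by case: st => fixp _ _ _; apply: fixp. Qed.
Let ltO a : a \in O -> a < i. Proof. by case: st => _ H _ _; apply: H. Qed.
Let neO a : a \in O -> a != i.
Proof. by move/ltO => lt_ai; rewrite -(inj_eq val_inj) neq_ltn lt_ai. Qed.

Lemma notin_chain_ends : i \notin O.
Proof. by apply/negP => /ltO; rewrite ltnn. Qed.

(** A valley has no arc to or from an earlier index: [p] is unchanged, and [i], a fixed point of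
    [p], becomes a one-element open chain. *)
Lemma extends_valley s :
  extends i p O s && cval s i = extends i.+1 p (i |: O) s.
Proof.
apply/andP/idP => [[es /andP[lt_i lt_is]]|es].
  apply/forallP => a; apply/implyP; rewrite ltnS leq_eqVlt !inE.
  case: (eqVneq a i) => [-> //|nai] /=.
  rewrite (inj_eq val_inj) (negbTE nai) /= => lt_ai.
  have := extendsP es lt_ai; case: ifP => [_|_ -> //].
  rewrite leq_eqVlt => /orP[/eqP/val_inj ei|//].
  by move: lt_i; rewrite {2}ei permK ltnNge (ltnW lt_ai).
have H (a : 'I_N) : a < i -> if a \in O then is_true (i < s a) else s a = p a.
  move=> lt_ai; have := extendsP es (ltnW lt_ai : a < i.+1).
  by rewrite !inE -(inj_eq val_inj) (ltn_eqF lt_ai).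
split.
  apply/forallP => a; apply/implyP => /H.
  by case: ifP => // [_ /ltnW|_ /eqP].
have lt_is : i < s i by have := extendsP es (ltnSn i); rewrite setU11.
apply/andP; split=> //; rewrite ltnNge leq_eqVlt; apply/norP; split.
  apply: contraTneq lt_is => /val_inj e.
  by rewrite -{2}e permKV ltnn.
apply/negP => lt_i; have := H _ lt_i; rewrite permKV ltnn.
case: ifP => // _ e; have := chain_state_lt (s^-1 i)%g st.
by rewrite -e ltnn lt_i.
Qed.

Lemma extends_peak_ends s : extends i p O s -> cpeak s i ->
  (s^-1 i)%g \in O /\ (p^-1 (s i))%g \in O.
Proof.
move=> es /andP[lt_i lt_si]; split.
  have := extendsP es lt_i; rewrite permKV; case: ifP => // _ e.
  by have := chain_state_lt (s^-1 i)%g st; rewrite -e ltnn lt_i.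
have lt_e : (p^-1 (s i))%g < i by rewrite -(chain_state_lt _ st) permKV.
have := extendsP es lt_e; case: ifP => // _; rewrite permKV => /perm_inj e.
by rewrite e ltnn in lt_e.
Qed.

(** The two new arcs are [s a = i] and [s i = p e], which is what [insert] records; the other ends
    stay open. *)
Lemma extends_peak s a e : a \in O -> e \in O ->
  [&& extends i p O s, cpeak s i, (s^-1 i)%g == a & (p^-1 (s i))%g == e]
  = extends i.+1 (insert p i a e) (O :\ a) s.
Proof.
move=> Oa Oe; have insE x := insertE x fixi (neO Oa) (neO Oe).
apply/and4P/idP => [[es pk /eqP ea /eqP ee]|es].
  have sa : s a = i by rewrite -ea permKV.
  have si : s i = p e by rewrite -ee permKV.
  apply/forallP => x; apply/implyP; rewrite ltnS leq_eqVlt !inE insE.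
  have [->|nxa] := eqVneq x a; first by rewrite sa eqxx.
  have [->|nxi] := eqVneq x i.
    by rewrite (negbTE notin_chain_ends) si eqxx andbF.
  rewrite (inj_eq val_inj) (negbTE nxi) /= => lt_xi; have := extendsP es lt_xi.
  case: ifP => [Ox|Ox ->].
    rewrite leq_eqVlt => /orP[/eqP/val_inj e1|//].
    by rewrite -sa in e1; rewrite (perm_inj e1) eqxx in nxa.
  by have [exe|//] := eqVneq x e; rewrite exe Oe in Ox.
have H (x : 'I_N) : x < i.+1 -> x != a ->
    if x \in O then is_true (i < s x) else s x = if x == i then p e else p x.
  move=> lt_xi nxa; have := extendsP es lt_xi; rewrite !inE nxa /=.
  case: ifP => // Ox ->; rewrite insE (negbTE nxa); case: ifP => // _.
  by case: ifP => // /eqP exe; rewrite exe Oe in Ox.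
have sa : s a = i.
  have := extendsP es (ltnW (ltO Oa) : a < i.+1).
  by rewrite !inE eqxx insE eqxx.
have si : s i = p e.
  have := H _ (ltnSn i); rewrite eq_sym (neO Oa) (negbTE notin_chain_ends) eqxx.
  by apply.
have ei : (s^-1 i)%g = a by rewrite -sa permK.
split; rewrite ?ei ?si ?permK ?eqxx //; last first.
  by rewrite /cpeak ei si (chain_state_lt _ st) !ltO.
apply/forallP => x; apply/implyP => lt_xi.
have [->|nxa] := eqVneq x a; first by rewrite Oa sa.
have nxi : (x == i) = false by rewrite -val_eqE /= ltn_eqF.
by have := H x (ltnW lt_xi) nxa; case: ifP => [_ /ltnW //|_ ->]; rewrite nxi.
Qed.

Lemma extends_valley_weight s : extends i p O s -> cval s i ->
  ucross i s + unest i s = #|O|.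
Proof.
move=> es vi; rewrite ucross_unestE //; apply: eq_card => x; rewrite inE.
have [lt_xi|le_ix] /= := ltnP x i; last first.
  by apply/esym/negP => /ltO; rewrite ltnNge le_ix.
have := extendsP es lt_xi; case: ifP => [_|_ ->].
  rewrite leq_eqVlt => /orP[/eqP/val_inj e|//].
  by move: vi; rewrite /cval {2}e permK ltnNge (ltnW lt_xi).
by rewrite ltnNge ltnW // (chain_state_lt _ st).
Qed.

Lemma extends_open s (l : 'I_N) : extends i p O s -> s l < i -> i < l ->
  exists2 x, x \in O & s l = p x.
Proof.
move=> es lt_sl lt_il; exists (p^-1 (s l))%g; last by rewrite permKV.
have lt_x : (p^-1 (s l))%g < i by rewrite -(chain_state_lt _ st) permKV.
have := extendsP es lt_x; case: ifP => // _; rewrite permKV => /perm_inj e.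
by move: lt_x; rewrite e ltnNge (ltnW lt_il).
Qed.

Lemma open_extends s x : extends i p O s -> x \in O -> p x != s i ->
  i < (s^-1 (p x))%g.
Proof.
move=> es Ox nx; rewrite ltnNge leq_eqVlt; apply/norP; split.
  by apply: contraNneq nx => /val_inj <-; rewrite permKV.
apply/negP => lt_i; have := extendsP es lt_i; rewrite permKV.
case: ifP => [_|Oy /perm_inj e]; last by rewrite -e Ox in Oy.
by rewrite leqNgt (chain_state_lt _ st) ltO.
Qed.

(** Arcs from after [i] to below [i] end exactly at the starts [p x] of open chains other than
    [s i], which [~~ Q (s i)] excludes. Taking [Q] as above or below [s i] yields [lcross] or
    [lnest]. *)
Lemma extends_peak_weight s (Q : pred nat) : extends i p O s ->
  ~~ Q (s i) ->
  #|[set l : 'I_N | [&& Q (s l), s l < i & i < l]]| = #|[set x in O | Q (p x)]|.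
Proof.
move=> es Qsi.
rewrite -(@card_imset _ _ (fun x => (s^-1 (p x))%g)); last first.
  by move=> x y /perm_inj/perm_inj.
apply: eq_card => l; rewrite inE; apply/and3P/imsetP => [[Ql lt_sl lt_il]|].
  have [x Ox slE] := extends_open es lt_sl lt_il.
  by exists x; rewrite ?inE ?Ox -slE ?permK.
case=> x; rewrite inE => /andP[Ox Qx] ->; rewrite permKV Qx.
split=> //; first by rewrite (chain_state_lt _ st) ltO.
by apply: open_extends => //; apply: contraNneq Qsi => <-.
Qed.

Lemma chain_state_valley : chain_state i.+1 p (i |: O) f.
Proof.
case: st => fixp _ fp f_inj; split=> // [a /ltnW/fixp //|a|].
  by rewrite !inE => /orP[/eqP-> //|/ltO/ltnW].
move=> a b /= Ha Hb; apply: f_inj; rewrite inE.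
  by move: Ha; rewrite !inE -orbA => /or3P[/eqP->|->|/ltnW->];
    rewrite ?leqnn ?orbT.
by move: Hb; rewrite !inE -orbA => /or3P[/eqP->|->|/ltnW->];
  rewrite ?leqnn ?orbT.
Qed.

Lemma chain_state_peak a e : a \in O -> e \in O ->
  exists f', chain_state i.+1 (insert p i a e) (O :\ a) f'.
Proof.
move=> Oa Oe; have insE x := insertE x fixi (neO Oa) (neO Oe).
case: st => fixp _ fp f_inj.
exists (fun x => if (x == i) || (f x == f a) then f e else f x); split.
- move=> x lt_ix; have nx (b : 'I_N) : b <= i -> (x == b) = false.
    by move=> le_bi; rewrite -(inj_eq val_inj) gtn_eqF // (leq_ltn_trans le_bi).
  by rewrite insE !nx ?fixp ?(ltnW lt_ix) // ltnW // ltO.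
- by move=> x; rewrite !inE => /andP[_ /ltO/ltnW].
- have npi b : b != i -> (p b == i) = false.
    by move=> nb; apply/eqP => e1; rewrite -fixi in e1;
      rewrite (perm_inj e1) eqxx in nb.
  move=> x; rewrite insE.
  have [->|nxa] := eqVneq x a; first by rewrite !eqxx orbT.
  have [->|nxi] := eqVneq x i.
    by rewrite npi ?neO //= fp; case: ifP.
  have [->|nxe] := eqVneq x e.
    by rewrite npi ?neO //= fp eqxx; case: ifP.
  by rewrite npi //= fp.
move=> x y /= Hx Hy.
have Dx z : z \in [pred a0 | (a0 \in O :\ a) || (i < a0)] ->
   [/\ (z == i) = false, (f z == f a) = false & (z \in O) || (i <= z)].
  rewrite !inE => Hz; have Dz : (z \in O) || (i <= z).
    by case/orP: Hz => [/andP[_ ->]//|/ltnW->]; rewrite orbT.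
  split=> //.
    by case/orP: Hz => [/andP[_ /neO/negbTE]//|lt_iz];
      rewrite -(inj_eq val_inj) gtn_eqF.
  apply/eqP => /f_inj; rewrite !inE Dz Oa => /(_ isT isT) e1.
  by move: Hz; rewrite e1 eqxx ltnNge (ltnW (ltO Oa)).
have [-> -> Ox] := Dx x Hx; have [-> -> Oy] := Dx y Hy.
by move=> /f_inj; apply; rewrite inE.
Qed.

(** The transposition of [e] and [i] merges the fixed point [i] into the chain of [e]; that of [a]
    and [e] merges two chains, or is trivial when [a = e]. *)
Lemma card_porbits_insert a e : a \in O -> e \in O ->
  #|porbits (insert p i a e)| + 1 + (a != e) = #|porbits p|.
Proof.
move=> Oa Oe; case: st => fixp _ fp f_inj.
have nei : f e <> f i.
  move=> /f_inj; rewrite !inE Oe leqnn orbT => /(_ isT isT) e1.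
  by have := ltO Oe; rewrite e1 ltnn.
have := porbits_mul_tperm p e i; rewrite /= neO //=.
rewrite (_ : e \notin porbit p i); last by apply/negP => /(invariant_porbit fp).
set p1 := (tperm e i * p)%g => card1.
(* Relabelling [i] as [f e] gives an invariant of [p1], which still separates the cycles of distinct
   ends. *)
have fp1 x : (if p1 x == i then f e else f (p1 x))
    = if x == i then f e else f x.
  rewrite /p1 permM; case: tpermP => [->|->|_ nxi].
  - by rewrite fixi eqxx; case: ifP.
  - by rewrite eqxx; case: eqP => // _; rewrite fp.
  case: (eqVneq (p x) i) => [e1|_]; last by rewrite fp (introF eqP nxi).
  by rewrite -fixi in e1; case: nxi; apply: perm_inj e1.
have := porbits_mul_tperm p1 a e; rewrite /= -/(insert p i a e).
have -> : (a \notin porbit p1 e) = (a != e).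
  congr (~~ _); apply/idP/eqP => [|->]; last exact: porbit_id.
  move/(invariant_porbit fp1); rewrite (negbTE (neO Oa)) (negbTE (neO Oe)).
  by move/f_inj; rewrite !inE Oa Oe; apply.
by move: card1; case: (a != e); lia.
Qed.

End Step.
End PartialPermutations.

(** * Summation over the extensions of a partial permutation *)

Section Transfer.
Variables (R : comNzRingType) (V : bool -> nat -> R).
Variables (W : bool -> nat -> nat -> R).
Variable z : R.

(** Every index changes the height by one, so the height before an index has the parity of its
    0-based value; hence [odd h] can stand for the parity of the index. *)
Definition rise_weight h : R := V (odd h) h.
Definition fall_weight h : R :=
  (z + h.-1%:R) * \sum_(r < h) W (odd h) (h.-1 - r)%N r.

Variable N : nat.
Implicit Types (p s : 'S_N) (O : {set 'I_N}) (f : 'I_N -> 'I_N).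

(** The default 0 annihilates permutations that are not cycle-alternating, so sums may run over all
    extensions. *)
Definition step_weight s (k : 'I_N) : R :=
  if cval s k then V (odd k) (ucross k s + unest k s)
  else if cpeak s k then W (odd k) (lcross k s) (lnest k s) else 0.

(** Among the cycles of [p], [c] are finished, [#|O|] are open chains and [m] are unread fixed
    points. Splitting on the type of index [i] reproduces the recursion of [dyck]. *)
Lemma sum_extends m c i p O f :
    (i + m = N)%N -> chain_state i p O f -> odd #|O| = odd i ->
    (#|porbits p| = c + #|O| + m)%N ->
  \sum_(s | extends i p O s) (\prod_(k < N | (i <= k)%N) step_weight s k)
                             * z ^+ cyc s
  = z ^+ c * dyck rise_weight fall_weight m #|O|.
Proof.
elim: m c i p O f => [|m IHm] c i p O f im st parO cardp.
  have eN : i = N by lia.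
  have [O0|[a Oa]] := set_0Vmem O; last first.
    have /negPf nO : #|O| != 0%N by rewrite (cardsD1 a) Oa.
    rewrite /= nO mulr0 big_pred0 // => s; apply/negP => es.
    have lt_ai : (a < i)%N by rewrite eN.
    have := extendsP es lt_ai; rewrite Oa => le_i.
    by have := leq_ltn_trans le_i (ltn_ord (s a)); rewrite eN ltnn.
  rewrite O0 cards0 !addn0 in cardp *; rewrite mulr1 (big_pred1 p) => [|s].
    rewrite big_pred0 ?mul1r /cyc ?cardp // => k.
    by rewrite eN leqNgt ltn_ord.
  apply/idP/eqP => [es|-> ]; last first.
    by apply/forallP => a; rewrite inE eqxx implybT.
  apply/permP => a; have lt_ai : (a < i)%N by rewrite eN.
  by have := extendsP es lt_ai; rewrite inE.
have lt_iN : (i < N)%N by lia.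
pose k : 'I_N := Ordinal lt_iN.
have prodE s : \prod_(j < N | (i <= j)%N) step_weight s j =
    step_weight s k * \prod_(j < N | (i.+1 <= j)%N) step_weight s j.
  rewrite (bigD1 k) //=; congr (_ * _); apply: eq_bigl => j.
  by rewrite -val_eqE /= ltn_neqAle andbC eq_sym.
have OV : #|k |: O| = #|O|.+1 by rewrite cardsU1 (notin_chain_ends (i := k) st).
rewrite (bigID (fun s => cval s k)) [dyck _ _ _ _]/= mulrDr /=; congr (_ + _).
  transitivity (V (odd i) #|O| * (\sum_(s | extends i.+1 p (k |: O) s)
      (\prod_(j < N | (i < j)%N) step_weight s j) * z ^+ cyc s)).
    rewrite mulr_sumr; apply: eq_big => [s|s /andP[es vs]].
      exact: (extends_valley (i := k) st).
    rewrite prodE /step_weight vs.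
    by rewrite (extends_valley_weight (i := k) st es vs) mulrA.
  rewrite (IHm c i.+1 p _ f) ?OV; first by rewrite /rise_weight parO mulrCA.
  - by lia.
  - exact: (chain_state_valley (i := k) st).
  - by rewrite /= parO.
  - by rewrite cardp; lia.
rewrite (bigID (fun s => cpeak s k)) /= [X in _ + X]big1 ?addr0; last first.
  move=> s /andP[/andP[_ nv] np].
  by rewrite prodE /step_weight (negbTE nv) (negbTE np) !mul0r.
have peak_val s : cpeak s k -> ~~ cval s k.
  by case/andP=> lt1 _; rewrite negb_and -leqNgt ltnW.
pose crosses e := #|[set x in O | (p e < p x)%N]|.
pose nests e := #|[set x in O | (p x < p e)%N]|.
have peakE a e : a \in O -> e \in O ->
    \sum_(s | [&& extends i p O s, cpeak s k, (s^-1 k)%g == a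
                & (p^-1 (s k))%g == e])
      (\prod_(j < N | (i <= j)%N) step_weight s j) * z ^+ cyc s
    = W (odd i) (crosses e) (nests e) *
      (z ^+ (c + (a == e)) * dyck rise_weight fall_weight m #|O|.-1).
  move=> Oa Oe; have [f' st'] := chain_state_peak (i := k) st Oa Oe.
  have cardO : #|O| = #|O :\ a|.+1 by rewrite (cardsD1 a O) Oa.
  rewrite cardO /= -(IHm _ i.+1 _ _ f' _ st'); first last.
  - have := card_porbits_insert (i := k) st Oa Oe; rewrite cardp cardO.
    by case: (a == e) => /=; lia.
  - by move: parO; rewrite cardO /= => <-; rewrite negbK.
  - by lia.
  rewrite mulr_sumr; apply: eq_big => [s|s /and4P[es pk _ /eqP ee]].
    exact: (extends_peak (i := k) st s Oa Oe).
  have ske : s k = p e by rewrite -ee permKV.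
  rewrite prodE /step_weight (negbTE (peak_val s pk)) pk -!mulrA.
  have lt_sk : (s k < k)%N by case/andP: pk.
  congr (W _ _ _ * _).
    rewrite lcrossE ske.
    apply: (extends_peak_weight (i := k) st (Q := fun l => p e < l)%N) => //.
    by rewrite ske ltnn.
  rewrite lnestE // ske /nests.
  have <- := extends_peak_weight (i := k) st (Q := fun l => l < p e)%N es.
    apply: eq_card => l; rewrite !inE andbC.
    by case: ltnP => //= lt1; rewrite (ltn_trans lt1) // -ske.
  by rewrite ske ltnn.
rewrite (partition_big (fun s => s^-1 k)%g (mem O)) /=; last first.
  move=> s /andP[/andP[es _] pk].
  by have [] := extends_peak_ends (i := k) st es pk.
transitivity (\sum_(a in O) \sum_(e in O) W (odd i) (crosses e) (nests e) *
      (z ^+ (c + (a == e)) * dyck rise_weight fall_weight m #|O|.-1)).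
  apply: eq_bigr => a Oa.
  rewrite (partition_big (fun s => p^-1 (s k))%g (mem O)) /=; last first.
    move=> s /andP[/andP[/andP[es _] pk] _].
    by have [] := extends_peak_ends (i := k) st es pk.
  apply: eq_bigr => e Oe; rewrite -peakE //; apply: eq_bigl => s.
  case pk: (cpeak s k); rewrite ?andbF //= ?andbT.
  by rewrite (peak_val s pk) andbT andbA.
(* With [e] fixed first, [W] leaves the sum over [a], and the sum over [e] becomes a sum over the
   ranks of [p e]. *)
rewrite exchange_big /= [fall_weight #|O|](erefl :
  _ = (z + #|O|.-1%:R) * \sum_(r < #|O|) W (odd #|O|) (#|O|.-1 - r)%N r) parO.
rewrite -(sum_rank2 (v := fun x => val (p x)) O (W (odd i))); last first.
  by move=> x y /val_inj/perm_inj.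
rewrite mulrA mulr_sumr mulr_sumr mulr_suml; apply: eq_bigr => e Oe.
(* Only the choice [a = e] closes a cycle. *)
have sum_close : \sum_(a in O) z ^+ (a == e) = z + #|O|.-1%:R.
  rewrite (bigD1 e) //= eqxx expr1; congr (z + _).
  rewrite (cardsD1 e O) Oe add1n /= -sum1_card natr_sum.
  apply: eq_big => [a|a /andP[_ /negbTE->]]; last by rewrite expr0.
  by rewrite !inE andbC.
rewrite -sum_close -/(crosses e) -/(nests e).
rewrite -[_ * _ * dyck _ _ _ _]mulrA mulr_suml mulr_suml mulr_sumr.
by apply: eq_bigr => a _; rewrite exprD; ring.
Qed.

(** Nothing has been read at the start: [p] is the identity, no chain is open and all [N] cycles are
    unread fixed points. *)
Lemma sum_step_weight :
  \sum_(s : 'S_N | cycle_alternating s)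
     (\prod_(k < N) if cval s k then V (odd k) (ucross k s + unest k s)
                    else W (odd k) (lcross k s) (lnest k s)) * z ^+ cyc s
  = dyck rise_weight fall_weight N 0.
Proof.
have st0 : chain_state 0 (1%g : 'S_N) set0 id.
  by split=> // [a _|a|a]; rewrite ?perm1 ?inE.
have := @sum_extends N 0 0 1 set0 id (erefl _) st0.
rewrite cards0 => /(_ erefl); rewrite add0n expr0 mul1r => <-; last first.
  rewrite !add0n /porbits card_in_imset ?card_ord // => x y _ _ /eqP.
  by rewrite eq_porbit_mem => /porbitP[j ->]; rewrite expg1n perm1.
rewrite [RHS](bigID (@cycle_alternating N)) /= [X in _ + X]big1 ?addr0.
  apply: eq_big => [s|s ca_s].
    rewrite (_ : extends _ _ _ _) //.
    by apply/forallP => a; rewrite ltn0.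
  congr (_ * _); apply: eq_bigr => k _.
  by rewrite /step_weight cpeakP //; case: ifP.
move=> s /andP[_ /forallPn[k nk]]; rewrite (bigD1 k) //= /step_weight.
suff [-> ->] : cval s k = false /\ cpeak s k = false by rewrite !mul0r.
move: nk; rewrite /cval /cpeak /cdrise /cdfall /fixpt.
have [sk|_] := eqVneq (s k) k; first by rewrite sk !ltnn !andbF.
rewrite andbT -negb_or negbK => /orP[] /andP[/ltnW lt1 /ltnW lt2].
  by rewrite (ltnNge k (s^-1 k)%g) lt1 (ltnNge (s k) k) lt2 andbF.
by rewrite (ltnNge (s^-1 k)%g k) lt1 (ltnNge k (s k)) lt2 andbF.
Qed.

End Transfer.

(** * The weights of the theorem *)

Section Monomials.
Variables (R : comNzRingType) (x y u p q r : bool -> R).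

Lemma expr_card (T : finType) (P : pred T) (a : R) :
  a ^+ #|[set i | P i]| = \prod_i (if P i then a else 1).
Proof.
rewrite -prodr_const -big_mkcond /=.
by apply: eq_bigl => i; rewrite inE.
Qed.

Lemma expr_sum_if (T : finType) (P : pred T) (e : T -> nat) (a : R) :
  a ^+ (\sum_(i | P i) e i) = \prod_i (if P i then a ^+ e i else 1).
Proof. by rewrite expr_sum big_mkcond. Qed.

(* The argument b is the parity of the 0-based index: b = true for the indices
   that are even in the 1-based convention of the statistics. *)
Definition valley_weight b h : R := y b * r b ^+ h.

(** For a peak, [ne = 0] means exclusive antirecord; otherwise it is a neither-record-antirecord. *)
Definition peak_weight b cr ne : R :=
  (if ne == 0%N then x b else u b) * p b ^+ cr * q b ^+ ne.

Lemma monomialE N (s : 'S_N) : cycle_alternating s ->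
    x true ^+ eareccpeak (@idx_even _) s * y true ^+ cvals (@idx_even _) s
  * u true ^+ nrcpeak (@idx_even _) s
  * x false ^+ eareccpeak (@idx_odd _) s * y false ^+ cvals (@idx_odd _) s
  * u false ^+ nrcpeak (@idx_odd _) s
  * p true ^+ lcrosscpeak (@idx_even _) s * q true ^+ lnestcpeak (@idx_even _) s
  * p false ^+ lcrosscpeak (@idx_odd _) s * q false ^+ lnestcpeak (@idx_odd _) s
  * r false ^+ (ucrosscval (@idx_odd _) s + unestcval (@idx_odd _) s)
  * r true ^+ (ucrosscval (@idx_even _) s + unestcval (@idx_even _) s)
  = \prod_(k < N) if cval s k
      then valley_weight (odd k) (ucross k s + unest k s)
      else peak_weight (odd k) (lcross k s) (lnest k s).
Proof.
move=> ca_s; rewrite !exprD !expr_card !expr_sum_if -!big_split /=.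
apply: eq_bigr => k _; rewrite /idx_even /idx_odd /= negbK cpeakP //.
case vk: (cval s k); rewrite /= ?andbF ?andbT.
  rewrite /valley_weight exprD.
  by case: (odd k); rewrite /= ?mul1r ?mulr1 ?mulrA.
have pk : cpeak s k by rewrite cpeakP // vk.
rewrite /exclusive_antirecord /neither_record_antirecord cpeak_record //.
rewrite cpeak_antirecord // /peak_weight andbT.
by case: (odd k); case: eqP => /= [->|_]; rewrite ?mul1r ?mulr1.
Qed.

(** The term [j = 0] is the antirecord; the others share a factor [q b], and reversing their order
    leaves the bracket. *)
Lemma sum_peak_weight b m :
  \sum_(j < m.+1) peak_weight b (m - j) j =
  p b ^+ m * x b + q b * pq_bracket (p b) (q b) m * u b.
Proof.
rewrite big_ord_recl /peak_weight /= subn0 mulr1 [x b * _]mulrC; congr (_ + _).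
rewrite /pq_bracket (reindex_inj rev_ord_inj) mulr_sumr mulr_suml /=.
apply: eq_bigr => j _; have lt_jm := ltn_ord j; rewrite /bump /= add1n.
rewrite (_ : (m - (m - j.+1).+1)%N = j); last by lia.
rewrite (_ : (m - j.+1)%N = (m - 1 - j)%N); last by lia.
by rewrite exprS; ring.
Qed.

(** A rise from [h] and a fall from [h + 1] occur at indices of opposite parity, which is why each
    coefficient mixes even peaks with odd valleys or conversely. *)
Lemma rise_fall_weight z h :
  rise_weight valley_weight h * fall_weight peak_weight z h.+1 =
  (z + h%:R) * (p (~~ odd h) ^+ h * x (~~ odd h)
    + q (~~ odd h) * pq_bracket (p (~~ odd h)) (q (~~ odd h)) h * u (~~ odd h))
  * r (odd h) ^+ h * y (odd h).
Proof.
by rewrite /rise_weight /fall_weight sum_peak_weight /valley_weight /=; ring.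
Qed.

End Monomials.

Definition by_parity (a b : ZX) (even : bool) : ZX := if even then a else b.

(** Subscript +1 belongs to odd valleys but -1 to even peaks, hence [p_p2] before [p_p1]. *)
Definition Qhat_valley : bool -> nat -> ZX :=
  valley_weight (by_parity y_e y_o) (by_parity p_p2 p_p1).

Definition Qhat_peak : bool -> nat -> nat -> ZX :=
  peak_weight (by_parity x_e x_o) (by_parity u_e u_o)
    (by_parity p_m1 p_m2) (by_parity q_m1 q_m2).

Lemma Qhat_dyck n :
  Qhat n = dyck (rise_weight Qhat_valley) (fall_weight Qhat_peak lam) (2 * n) 0.
Proof.
rewrite -sum_step_weight; apply: eq_bigr => s ca_s; congr (_ * _).
exact: (monomialE (by_parity x_e x_o) (by_parity y_e y_o) (by_parity u_e u_o)
  (by_parity p_m1 p_m2) (by_parity q_m1 q_m2) (by_parity p_p2 p_p1) ca_s).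
Qed.

Theorem theorem5p2 (alpha : nat -> ZX)
  (alpha_odd : forall k : nat, (1 <= k)%N ->
    alpha (2 * k - 1)%N =
      (lam + (2 * k - 2)%:R)
      * (p_m1 ^+ (2 * k - 2) * x_e
         + q_m1 * pq_bracket p_m1 q_m1 (2 * k - 2) * u_e)
      * p_p1 ^+ (2 * k - 2) * y_o)
  (alpha_even : forall k : nat, (1 <= k)%N ->
    alpha (2 * k)%N =
      (lam + (2 * k - 1)%:R)
      * (p_m2 ^+ (2 * k - 1) * x_o
         + q_m2 * pq_bracket p_m2 q_m2 (2 * k - 1) * u_o)
      * p_p2 ^+ (2 * k - 1) * y_e) :
  is_sfrac Qhat alpha.
Proof.
have alphaE h : alpha h.+1 =
    rise_weight Qhat_valley h * fall_weight Qhat_peak lam h.+1.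
  (* In both parities [k = h./2.+1]: [h] is [2k - 1] if odd and [2k - 2] if even. *)
  rewrite rise_fall_weight; have := odd_double_half h.
  case: (odd h) => eh.
    have e : (2 * h./2.+1 - 1 = h)%N by lia.
    have := alpha_even h./2.+1 isT; rewrite e.
    by rewrite (_ : (2 * h./2.+1)%N = h.+1); last by lia.
  have e : (2 * h./2.+1 - 2 = h)%N by lia.
  have := alpha_odd h./2.+1 isT; rewrite e.
  by rewrite (_ : (2 * h./2.+1 - 1)%N = h.+1); last by lia.
have fall0 : fall_weight Qhat_peak lam 0 = 0.
  by rewrite /fall_weight big_ord0 mulr0.
move=> n; have [K0 cvg] := is_sfrac_dyck fall0 alphaE n.
by exists K0 => K /cvg ->; rewrite Qhat_dyck.
Qed.
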